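(* For every positive integer $n$, the characteristic polynomial of the adjacency matrix of the strong power graph $\mathcal{P}_s(\mathbb{Z}_n)$ is $$\Phi(\mathcal{P}_s(\mathbb{Z}_n),x)=(x+1)^{n-3}\Big(x^3+(3-n)x^2+(3-2n+\phi(n))x+(n-\phi(n)-1)(\phi(n)-1)\Big),$$ where $\phi$ is Euler's totient function.
   Context: For a finite group $G$ of order $n$, the strong power graph $\mathcal{P}_s(G)$ is the simple graph with vertex set $G$ in which two distinct vertices $x,y$ are adjacent if and only if $x^{n_1}=y^{n_2}$ for some positive integers $n_1,n_2<n$. $\mathbb{Z}_n=\{0,1,\ldots,n-1\}$ is the cyclic group of order $n$ under addition modulo $n$ (so $x^{n_1}$ means $n_1x$). For a graph $\Gamma$, $A(\Gamma)$ is its $0/1$ adjacency matrix and $\Phi(\Gamma,x)=\det(xI-A(\Gamma))$.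
   Formalization: The formula is proved for every n ≥ 2 (as an identity of rational functions, so that n = 2 makes sense); n = 1 is excluded because there Φ = x, while the right-hand side is (x³+2x²+2x)/(x+1)² with φ(1) = 1, so the claim fails. *)

(* Defs.v *)
From HB Require Import structures.
From mathcomp Require Import all_boot all_order all_algebra all_fingroup.

Set Implicit Arguments.
Unset Strict Implicit.
Unset Printing Implicit Defensive.

Import GRing.Theory.
Local Open Scope ring_scope.

Definition adjacency_mx (T : finType) (e : rel T) : 'M[int]_#|T| :=
  \matrix_(i, j) (e (enum_val i) (enum_val j))%:R.

(* [char_poly A] is [\det ('X%:M - map_mx polyC A)]. *)
Definition graph_char_poly (T : finType) (e : rel T) : {poly int} :=
  char_poly (adjacency_mx e).

Definition strong_power_graph (gT : finGroupType) : rel gT :=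
  fun x y => (x != y) &&
    [exists n1 : 'I_#|gT|, exists n2 : 'I_#|gT|,
       [&& (0 < n1)%N, (0 < n2)%N & (x ^+ n1 == y ^+ n2)%g]].

Lemma strong_power_graphP (gT : finGroupType) (x y : gT) :
  reflect (x <> y /\ exists n1 n2 : nat,
             [/\ (0 < n1 < #|gT|)%N, (0 < n2 < #|gT|)%N
               & (x ^+ n1 = y ^+ n2)%g])
          (strong_power_graph x y).
Proof.
apply: (iffP andP) => [[/eqP xy /existsP[n1 /existsP[n2 /and3P[p1 p2 /eqP e]]]]|].
  by split=> //; exists n1, n2; rewrite p1 p2 !ltn_ord.
case=> /eqP xy [n1 [n2 [/andP[p1 l1] /andP[p2 l2] e]]]; split=> //.
apply/existsP; exists (Ordinal l1); apply/existsP; exists (Ordinal l2).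
by rewrite /= p1 p2 e eqxx.
Qed.

Lemma strong_power_graph_irr (gT : finGroupType) :
  irreflexive (@strong_power_graph gT).
Proof. by move=> x; rewrite /strong_power_graph eqxx. Qed.

Lemma strong_power_graph_sym (gT : finGroupType) :
  symmetric (@strong_power_graph gT).
Proof.
move=> x y; apply/strong_power_graphP/strong_power_graphP;
by move=> [ne [n1 [n2 [h1 h2 e]]]]; split; [exact: nesym | exists n2, n1].
Qed.

(* Main.v *)
(** In [Z_n] two non-generators have a common power [0], and every nonzero
    element is a power of each generator; hence the strong power graph is the
    complete graph minus the edges joining [0] to the generators. Its adjacency
    matrix plus the identity is therefore a product [U V] of an [n x 3] and a
    [3 x n] matrix, and with [y = x + 1] the identity
    [y^3 det(y I_n - U V) = y^n det(y I_3 - V U)] reduces the characteristic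
    polynomial to a [3 x 3] determinant. *)

Require Import Defs.
From HB Require Import structures.
From mathcomp Require Import all_boot all_order all_algebra all_fingroup ring.

Set Implicit Arguments.
Unset Strict Implicit.
Unset Printing Implicit Defensive.

Import GRing.Theory.
Local Open Scope ring_scope.

(** Both sides come from the block matrix [[a, U; V, 1]]. Clearing [V] by column operations gives
    [\det (a%:M - U *m V)]. Multiplying on the left by [[1, 0; -V, a]], of determinant [a ^+ m],
    gives the triangular [[a, U; 0, a - V U]]. No division by [a] occurs. *)
Lemma det_scalar_sub_mulmxC (R : comPzRingType) (n m : nat) (a : R)
    (U : 'M[R]_(n, m)) (V : 'M[R]_(m, n)) :
  a ^+ m * \det (a%:M - U *m V) = a ^+ n * \det (a%:M - V *m U).
Proof.
have D1 : \det (block_mx a%:M U V 1%:M) = \det (a%:M - U *m V).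
  have := det_mulmx (block_mx a%:M U V 1%:M) (block_mx 1%:M 0 (- V) 1%:M).
  rewrite mulmx_block !(mulmx1, mulmx0, mulmxN, mul1mx, add0r, subrr).
  by rewrite det_ublock det_lblock !det1 !mulr1.
have := det_mulmx (block_mx 1%:M 0 (- V) a%:M) (block_mx a%:M U V 1%:M).
rewrite mulmx_block !(mul1mx, mul0mx, mulNmx, addr0, mulmx1) mul_mx_scalar.
rewrite mul_scalar_mx addNr det_ublock det_lblock D1 !det_scalar expr1n mul1r.
by rewrite [- _ + _]addrC => <-.
Qed.

Lemma det_mx33 (R : comNzRingType) (f : nat -> nat -> R) :
  \det (\matrix_(i < 3, j < 3) f i j) =
    f 0%N 0%N * (f 1%N 1%N * f 2%N 2%N - f 1%N 2%N * f 2%N 1%N)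
  - f 0%N 1%N * (f 1%N 0%N * f 2%N 2%N - f 1%N 2%N * f 2%N 0%N)
  + f 0%N 2%N * (f 1%N 0%N * f 2%N 1%N - f 1%N 1%N * f 2%N 0%N).
Proof.
rewrite (expand_det_row _ ord0) !big_ord_recl big_ord0 /cofactor.
rewrite !(expand_det_row _ ord0) !big_ord_recl !big_ord0 /cofactor !det_mx11.
rewrite !mxE /= /bump !(leq0n, add0n, addn0, addn1, ltn0, leqnn) /=.
rewrite !(expr0, expr1).
ring.
Qed.

Lemma Zp_expg_eq1 (m : nat) (x : 'I_m.+2) :
  ~~ coprime m.+2 x -> exists2 k, (0 < k < m.+2)%N & (x ^+ k = 1)%g.
Proof.
set N := m.+2 => ncop; set d := gcdn N x.
have d_gt0 : (0 < d)%N by rewrite gcdn_gt0.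
have d_gt1 : (1 < d)%N by rewrite ltn_neqAle eq_sym d_gt0 andbT.
(* This is below [N] because [d > 1], and [(N / d) x = N (x / d)] vanishes modulo [N]. *)
exists (N %/ d)%N.
  by rewrite divn_gt0 // dvdn_leq ?dvdn_gcdl //= ltn_Pdiv.
apply: val_inj; rewrite Zp_expg /=; apply/eqP; rewrite -/(dvdn _ _).
by rewrite muln_divA ?dvdn_gcdl // mulnC -muln_divA ?dvdn_gcdr ?dvdn_mulr.
Qed.

Lemma Zp_expg_onto (m : nat) (x y : 'I_m.+2) :
  coprime m.+2 x -> y != 0 -> exists2 k, (0 < k < m.+2)%N & (x ^+ k = y)%g.
Proof.
move=> cop y0; have xu : (x : 'Z_m.+2) \is a GRing.unit by [].
(* The exponent solves [k x = y] in the ring ['Z_m.+2]; its representative is positive because [y]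
   is nonzero. *)
exists (val ((x : 'Z_m.+2)^-1 * y)).
  rewrite [(_ < m.+2)%N]ltn_ord andbT lt0n; apply: contra y0 => /eqP k0.
  have /(congr1 ( *%R (x : 'Z_m.+2))) : (x : 'Z_m.+2)^-1 * y = 0.
    exact: val_inj.
  by rewrite mulVKr // mulr0 => ->.
by rewrite FinRing.zmodXgE -[LHS](@mulr_natr 'Z_m.+2) natr_Zp mulVKr.
Qed.

Lemma Zp_expg_neq1 (m : nat) (x : 'I_m.+2) (k : nat) :
  coprime m.+2 x -> (0 < k < m.+2)%N -> (x ^+ k)%g != 1%g.
Proof.
move=> cop /andP[k0 kN]; rewrite -val_eqE Zp_expg /= -/(dvdn _ _).
by rewrite Gauss_dvdr // gtnNdvd.
Qed.

Lemma strong_power_graph_Zp (m : nat) (x y : 'Z_m.+2) :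
  strong_power_graph x y =
  [&& x != y, ~~ ((x == 0) && coprime m.+2 y)
            & ~~ ((y == 0) && coprime m.+2 x)].
Proof.
have ncop0 : ~~ coprime m.+2 (0%R : 'Z_m.+2) by rewrite /coprime gcdn0.
have no_edge (z : 'Z_m.+2) : coprime m.+2 z -> strong_power_graph (0 : 'Z_m.+2) z = false.
  (* Every power of [0] is [0], which a generator does not reach with a positive exponent below its
     order. *)
  move=> cop; apply/strong_power_graphP => -[_ [n1 [n2 [_ h2]]]].
  by rewrite expg1n => /esym/eqP; apply/negP/Zp_expg_neq1; rewrite card_ord in h2 *.
have gen_edge (z t : 'Z_m.+2) : coprime m.+2 z -> t != 0 -> z != t ->
    strong_power_graph z t.
  move=> cop t0 zt; apply/strong_power_graphP; split; first exact/eqP.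
  have [k hk e] := Zp_expg_onto cop t0.
  by exists k, 1%N; rewrite card_ord hk expg1.
have nongen_edge (z t : 'Z_m.+2) : ~~ coprime m.+2 z -> ~~ coprime m.+2 t ->
    z != t -> strong_power_graph z t.
  move=> /Zp_expg_eq1[k hk ek] /Zp_expg_eq1[l hl el] /eqP zt.
  apply/strong_power_graphP; split=> //.
  by exists k, l; rewrite card_ord hk hl ek el.
have [-> | x_neq_y] := eqVneq x y; first by rewrite strong_power_graph_irr.
have [cx | ncx] := boolP (coprime m.+2 x); last first.
  rewrite andbF andbT /=; have [cy | ncy] := boolP (coprime m.+2 y); last first.
    by rewrite andbF nongen_edge.
  rewrite andbT; have [-> | x_neq0] := eqVneq x 0; first exact: no_edge.
  by rewrite strong_power_graph_sym gen_edge // eq_sym.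
have [x0 | x_neq0] := eqVneq x 0; first by rewrite x0 (negbTE ncop0) in cx.
rewrite andbT; have [-> | y_neq0] := eqVneq y 0; last exact: gen_edge.
by rewrite strong_power_graph_sym no_edge.
Qed.

Lemma sum_enum_val (R : nmodType) (T : finType) (F : T -> R) :
  \sum_(i < #|T|) F (enum_val i) = \sum_x F x.
Proof.
rewrite [RHS](reindex (fun i : 'I_#|T| => enum_val i)) //.
exact/onW_bij/enum_val_bij.
Qed.

Lemma sum_coprime_Zp (R : pzSemiRingType) (m : nat) :
  \sum_(x : 'Z_m.+2) (coprime m.+2 x)%:R = (totient m.+2)%:R :> R.
Proof. by rewrite totient_count_coprime big_mkord natr_sum. Qed.

(* With [e] and [g] the indicators of [0] and of the generators, the adjacency
   matrix is [1 1^T - e g^T - g e^T - I]; [U] and [V] factor its first three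
   terms. *)
Lemma graph_char_poly_Zp (m : nat) :
  let N : {poly int} := m.+2%:R in let f : {poly int} := (totient m.+2)%:R in
  let Y : {poly int} := 'X + 1 in
  Y ^+ 3 * graph_char_poly (@strong_power_graph 'Z_m.+2) =
  Y ^+ m.+2 * (Y ^+ 3 - N * Y ^+ 2 + f * Y + N * f - f - f ^+ 2).
Proof.
move=> N f Y.
pose e (x : 'Z_m.+2) : {poly int} := (x == 0)%:R.
pose g (x : 'Z_m.+2) : {poly int} := (coprime m.+2 x)%:R.
pose u x := nth 0 [:: 1; - e x; - g x].
pose v x := nth 0 [:: 1; g x; e x].
pose U := \matrix_(i < #|'Z_m.+2|, k < 3) u (enum_val i) k.
pose V := \matrix_(k < 3, i < #|'Z_m.+2|) v (enum_val i) k.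
have -> : graph_char_poly (@strong_power_graph 'Z_m.+2) = \det (Y%:M - U *m V).
  congr (\det _); apply/matrixP => i j; rewrite !mxE strong_power_graph_Zp.
  rewrite !big_ord_recl big_ord0 !mxE /u /v /= /e /g -(inj_eq enum_val_inj).
  set x := enum_val i; set y := enum_val j.
  have cop0 (z : 'Z_m.+2) : coprime m.+2 z -> (z == 0) = false.
    by apply: contraTF => /eqP ->; rewrite /coprime gcdn0.
  (* On the diagonal [e x * g x = 0], so [U *m V] has entry [1] and [Y - 1] is ['X], as the absence
     of loops demands. *)
  have [<- | x_neq_y] := eqVneq x y; rewrite /=.
    by case: (boolP (coprime _ x)) => [/cop0 ->|_];
      rewrite /= polyC0 /Y; case: (x == 0) => /=; ring.
  case: (boolP (coprime _ x)) => [/cop0 ->|_];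
  case: (boolP (coprime _ y)) => [/cop0 ->|_] //=;
  case: (x == 0); case: (y == 0) => /=; rewrite ?(polyC0, polyC1); ring.
rewrite det_scalar_sub_mulmxC; congr (_ * _); first by rewrite card_ord.
(* Indexing the entries by [nat] gives the form that [det_mx33] expands. *)
pose w (k l : nat) : {poly int} :=
  Y *+ (k == l) - \sum_(x : 'Z_m.+2) v x k * u x l.
have -> : Y%:M - V *m U = \matrix_(k < 3, l < 3) w k l.
  apply/matrixP => k l; rewrite !mxE /w -[k == l]val_eqE; congr (_ - _).
  by rewrite -[RHS]sum_enum_val; apply: eq_bigr => i _; rewrite !mxE.
(* The entries of [V *m U] are sums of products of [1], [e] and [g] up to sign; as [e] and [g] are
   indicators with disjoint supports, each sum is [N], [f], [1] or [0]. *)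
have s1 : \sum_(x : 'Z_m.+2) 1 = N by rewrite sumr_const card_ord.
have sg : \sum_x g x = f by apply: sum_coprime_Zp.
have se : \sum_x e x = 1.
  by rewrite (bigD1 0) //= big1 ?addr0 /e ?eqxx // => x /negbTE ->.
have sgg : \sum_x g x * g x = f.
  by rewrite -sg; apply: eq_bigr => x _; rewrite /g; case: coprime; rewrite (mulr1, mulr0).
have see : \sum_x e x * e x = 1.
  by rewrite -se; apply: eq_bigr => x _; rewrite /e; case: (x == 0); rewrite (mulr1, mulr0).
have sge : \sum_x g x * e x = 0.
  rewrite big1 // => x _; rewrite /g /e; case: eqVneq => [->|_]; last by rewrite mulr0.
  by rewrite /coprime gcdn0 mul0r.
have seg : \sum_x e x * g x = 0.
  by rewrite -[RHS]sge; apply: eq_bigr => x _; rewrite mulrC.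
have sum1r F : \sum_(x : 'Z_m.+2) 1 * F x = \sum_x F x :> {poly int}.
  by apply: eq_bigr => x _; rewrite mul1r.
have sumr1 F : \sum_(x : 'Z_m.+2) F x * 1 = \sum_x F x :> {poly int}.
  by apply: eq_bigr => x _; rewrite mulr1.
have sumrN F G :
    \sum_(x : 'Z_m.+2) F x * - G x = - \sum_x F x * G x :> {poly int}.
  by rewrite -sumrN; apply: eq_bigr => x _; rewrite mulrN.
rewrite det_mx33 /w /u /v /= !sumrN !sumr1 !sum1r s1 sg se sgg see sge seg.
ring.
Qed.

(** The equation is stated between fractions because the exponent [n - 3] is negative at [n = 2]. *)
Theorem theorem2p5 (n : nat) (n_gt1 : (1 < n)%N) :
  tofrac (graph_char_poly (@strong_power_graph 'Z_n)) =
  tofrac ('X + 1) ^ (n%:Z - 3) *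
  tofrac ('X^3 + (3 - n%:Z) *: 'X^2
          + (3 - 2 * n%:Z + (totient n)%:Z) *: 'X
          + ((n%:Z - (totient n)%:Z - 1) * ((totient n)%:Z - 1))%:P)
  :> {fraction {poly int}}.
Proof.
case: n n_gt1 => [|[|m]] // _.
have Y_neq0 : tofrac ('X + 1 : {poly int}) != 0.
  by rewrite tofrac_eq0 -polyC1 -size_poly_eq0 size_XaddC.
have Y3_neq0 : tofrac ('X + 1 : {poly int}) ^+ 3 != 0 by rewrite expf_neq0.
(* Multiplying by the nonzero cube turns the exponent into the natural number [m.+2] and leaves an
   identity of polynomials. *)
apply: (mulfI Y3_neq0); rewrite mulrA.
have -> : tofrac ('X + 1 : {poly int}) ^+ 3 * tofrac ('X + 1) ^ (m.+2%:Z - 3)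
    = tofrac ('X + 1) ^+ m.+2.
  by rewrite exprnP -expfzDr // (_ : 3%:Z + _ = m.+2%:Z) //; ring.
rewrite -!tofracXn -!tofracM graph_char_poly_Zp; congr (tofrac (_ * _)).
rewrite -!mul_polyC !(polyCD, polyCM, polyCN) -!natz !rmorph_nat.
ring.
Qed.
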